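(* Let $C$ be an $[n,k]_q$ linear code, let $\mathcal{P}$ be the multiset of points of $PG(\mathbb{F}_q^k)$ associated with $C$ via a generator matrix, and let $c\in C$ be a non-zero codeword with corresponding hyperplane $H_c$. Then $c$ is minimal if and only if $\langle \mathcal{P}\cap H_c\rangle = H_c$ or, equivalently, $\dim(\langle \mathcal{P}\cap H_c\rangle)=k-1$.
   Context: $\mathbb{F}_q$ is the finite field with $q$ elements. An $[n,k]_q$ linear code $C$ is a $k$-dimensional subspace of $\mathbb{F}_q^n$; all codes are assumed to have $k\ge 1$ and effective length $n$, i.e. every coordinate position is non-zero in some codeword. The support of $c\in\mathbb{F}_q^n$ is $\operatorname{supp}(c)=\{i : c_i\neq 0\}$. A codeword $c\in C\setminus\{\mathbf 0\}$ is called minimal if its support does not properly contain the support of another non-zero codeword of $C$. The projective space $PG(\mathbb{F}_q^k)$ has as points the 1-dimensional subspaces and as hyperplanes the $(k-1)$-dimensional subspaces of $\mathbb{F}_q^k$; all dimensions are vector space dimensions. Fix a generator matrix $G\in\mathbb{F}_q^{k\times n}$ of $C$ (its rows form a basis of $C$) with columns $G_1,\dots,G_n$ (all non-zero). The multiset of points associated with $C$ is $\mathcal{P}=\{\langle G_1\rangle,\dots,\langle G_n\rangle\}$. A non-zero codeword $c=aG$, with $a\in\mathbb{F}_q^k\setminus\{0\}$ a row vector, corresponds to the hyperplane $H_c=\{x\in\mathbb{F}_q^k : a x=0\}$, so that $c_i=0$ if and only if $\langle G_i\rangle\subseteq H_c$. $\mathcal{P}\cap H_c$ denotes the points of $\mathcal{P}$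 contained in $H_c$, and $\langle\cdot\rangle$ denotes the linear span (the span of the empty set being $\{0\}$). *)

(* Defs.v *)
From HB Require Import structures.
From mathcomp Require Export all_boot all_order all_algebra.
From mathcomp Require Export finmap multiset.

Set Implicit Arguments.
Unset Strict Implicit.
Unset Printing Implicit Defensive.

Import GRing.Theory.
Local Open Scope ring_scope.

(* The finite field F_q is an arbitrary F : finFieldType, with q = #|F|.      *)

(* The standing assumptions k >= 1 and "effective length n" are included.     *)
Definition is_linear_code (F : finFieldType) (n k : nat)
    (C : {vspace 'rV[F]_n}) : Prop :=
  [/\ (1 <= k)%N, \dim C = k
    & forall i : 'I_n, exists2 c : 'rV[F]_n, c \in C & c 0 i != 0].

Definition supp (F : finFieldType) (n : nat) (c : 'rV[F]_n) : {set 'I_n} :=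
  [set i | c 0 i != 0].

Definition minimal_codeword (F : finFieldType) (n : nat)
    (C : {vspace 'rV[F]_n}) (c : 'rV[F]_n) : Prop :=
  [/\ c \in C, c != 0
    & forall c' : 'rV[F]_n,
        c' \in C -> c' != 0 -> ~~ (supp c' \proper supp c)].

Definition is_generator_matrix (F : finFieldType) (n k : nat)
    (C : {vspace 'rV[F]_n}) (G : 'M[F]_(k, n)) : Prop :=
  basis_of C [seq row i G | i <- enum 'I_k].

Definition point_multiset (F : finFieldType) (n k : nat)
    (G : 'M[F]_(k, n)) : {mset {vspace 'cV[F]_k}}%mset :=
  seq_mset [seq <[col i G]>%VS | i <- enum 'I_n].

Definition hyperplane (F : finFieldType) (k : nat)
    (a : 'rV[F]_k) : {vspace 'cV[F]_k} :=
  lker (linfun (mulmx a : 'cV[F]_k -> 'M[F]_(1, 1))).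

Lemma mem_hyperplane (F : finFieldType) (k : nat) (a : 'rV[F]_k)
    (x : 'cV[F]_k) : (x \in hyperplane a) = (a *m x == 0).
Proof. by rewrite memv_ker lfunE. Qed.

Definition points_in (F : finFieldType) (k : nat)
    (P : {mset {vspace 'cV[F]_k}}%mset) (H : {vspace 'cV[F]_k}) :
    {mset {vspace 'cV[F]_k}}%mset :=
  seq_mset [seq p <- P | (p <= H)%VS].

Definition span_points (F : finFieldType) (k : nat)
    (P : {mset {vspace 'cV[F]_k}}%mset) : {vspace 'cV[F]_k} :=
  (\sum_(p <- P) p)%VS.

(* Main.v *)
Require Import Defs.
Import GRing.Theory.
Local Open Scope ring_scope.

(** With c = a G, the codeword b G has its support inside that of c exactly
    when the span S of the points in H_a lies in H_b.  If S = H_a, such a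
    non-zero b G has H_b = H_a, hence the same support as c.  If S is smaller,
    choose x in H_a outside S and b vanishing on S with b x <> 0: subtracting
    from b G the multiple of c that cancels one coordinate in the support of c
    gives a codeword contradicting minimality, and it is non-zero because its
    coefficient vector still does not vanish at x. *)

Lemma codewordE {F : finFieldType} {n k : nat} (G : 'M[F]_(k, n))
    (b : 'rV[F]_k) (i : 'I_n) : ((b *m G) 0 i == 0) = (col i G \in hyperplane b).
Proof.
rewrite mem_hyperplane colE mulmxA -colE.
apply/eqP/eqP => [b0|/matrixP/(_ 0 0)].
  by apply/matrixP => r s; rewrite !ord1 !mxE -[RHS]b0 mxE.
by rewrite !mxE.
Qed.

(** A sum of subspaces lies in [W] iff every summand does, and a line does iff its generator does.
    Multiplicities thus drop out, and inclusions can be tested column by column. *)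
Lemma span_points_in_subP {F : finFieldType} {n k : nat} {G : 'M[F]_(k, n)}
    {H W : {vspace 'cV[F]_k}} :
  reflect (forall i, col i G \in H -> col i G \in W)
    (span_points (points_in (point_multiset G) H) <= W)%VS.
Proof.
rewrite /span_points /points_in.
set s := [seq p <- _ | _].
have mem_s p : (p \in s) =
    (p <= H)%VS && (p \in [seq <[col i G]>%VS | i <- enum 'I_n]).
  by rewrite mem_filter (perm_mem (perm_eq_seq_mset _)).
(* The sum does not depend on the order of the points; indexing it by positions in [s] gives the
   shape that [subv_sumP] expects. *)
rewrite (perm_big _ (perm_eq_seq_mset s)) /= big_tnth.
apply: (iffP subv_sumP) => [sub i iH | sub j _].
  have /(tnthP (in_tuple s))[j defj] : <[col i G]>%VS \in s.
    by rewrite mem_s -memvE iH; apply/mapP; exists i; rewrite ?mem_enum.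
  by rewrite memvE defj sub.
have : tnth (in_tuple s) j \in s := mem_tnth j (in_tuple s).
rewrite mem_s andbC => /andP[/mapP[i _ ->]].
by rewrite -!memvE; apply: sub.
Qed.

Lemma span_points_in_sub {F : finFieldType} {n k : nat} (G : 'M[F]_(k, n))
    (H : {vspace 'cV[F]_k}) :
  (span_points (points_in (point_multiset G) H) <= H)%VS.
Proof. exact/span_points_in_subP. Qed.

(** By contraposition, inclusion of supports means that each zero of [a *m G] is a zero of [b *m G],
    and zeros are columns lying in the hyperplane. *)
Lemma supp_sub_span_points {F : finFieldType} {n k : nat} (G : 'M[F]_(k, n))
    (a b : 'rV[F]_k) :
  (supp (b *m G) \subset supp (a *m G)) =
  (span_points (points_in (point_multiset G) (hyperplane a)) <= hyperplane b)%VS.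
Proof.
apply/subsetP/span_points_in_subP => sub i.
  by have := sub i; rewrite !inE !codewordE => /contraLR.
by rewrite !inE !codewordE; apply/contra/sub.
Qed.

(** Rank-nullity: a non-zero entry of [a] is the value of the functional at a unit vector, so its
    image is the full one-dimensional target. *)
Lemma dim_hyperplane {F : finFieldType} {k : nat} (a : 'rV[F]_k) :
  a != 0 -> \dim (hyperplane a) = (k - 1)%N.
Proof.
move=> /rV0Pn[i ai0]; pose f := linfun (mulmx a : 'cV[F]_k -> 'M[F]_(1, 1)).
have dim_img : \dim (limg f) = 1%N.
  apply/eqP; rewrite eqn_leq; apply/andP; split.
    by rewrite (leq_trans (dimvS (subvf _))) // dimvf.
  rewrite lt0n dimv_eq0; apply: contraNneq ai0 => img0.
  have : f (delta_mx i 0) \in limg f by rewrite memv_img ?memvf.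
  rewrite img0 memv0 lfunE /= -colE => /eqP/matrixP/(_ 0 0).
  by rewrite !mxE => ->.
have := limg_ker_dim f fullv.
rewrite capfv dim_img dimvf dim_matrix mulr1 => dimE.
by rewrite -[X in (X - 1)%N]dimE addnK.
Qed.

(** The map [f], identity minus a projection onto [S], has kernel exactly [S]; hence some coordinate
    of [f x] is non-zero, and that coordinate of [f] is the required functional. *)
Lemma separating_hyperplane {F : finFieldType} {k : nat}
    {S : {vspace 'cV[F]_k}} {x : 'cV[F]_k} :
  x \notin S -> exists2 b, (S <= hyperplane b)%VS & x \notin hyperplane b.
Proof.
move=> xS; pose f := (\1 - projv S)%VF.
have fE y : f y = y - projv S y by rewrite !lfunE /= !lfunE.
have /cV0Pn[i fxi] : f x != 0.
  by rewrite fE subr_eq0; apply: contraNneq xS => ->; apply: memv_proj.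
(* This is row [i] of the matrix of [f]. *)
pose b := \row_j f (delta_mx j 0) i 0.
have bE y : (b *m y) 0 0 = f y i 0.
  have {2}-> : y = \sum_j y j 0 *: delta_mx j 0.
    by rewrite {1}[y]matrix_sum_delta; apply: eq_bigr => j _; rewrite big_ord1.
  rewrite linear_sum summxE mxE; apply: eq_bigr => j _.
  by rewrite linearZ !mxE mulrC.
exists b; last first.
  by rewrite mem_hyperplane; apply: contraNneq fxi => b0; rewrite -bE b0 mxE.
apply/subvP => y yS; rewrite mem_hyperplane; apply/eqP/matrixP => r s.
by rewrite !ord1 bE fE projv_id // subrr !mxE.
Qed.

Definition encoder {F : finFieldType} {n k : nat} (G : 'M[F]_(k, n)) :
    'Hom('rV[F]_k, 'rV[F]_n) :=
  linfun (mulmxr G : 'rV[F]_k -> 'rV[F]_n).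

Lemma encoderE {F : finFieldType} {n k : nat} (G : 'M[F]_(k, n)) b :
  encoder G b = b *m G.
Proof. by rewrite lfunE. Qed.

Lemma generator_codewords {F : finFieldType} {n k : nat}
    {C : {vspace 'rV[F]_n}} {G : 'M[F]_(k, n)} :
  is_generator_matrix C G -> limg (encoder G) = C.
Proof.
case/andP => /eqP <- _; apply/eqP; rewrite eqEsubv; apply/andP; split.
  apply/subvP => _ /memv_imgP[b _ ->]; rewrite encoderE mulmx_sum_row.
  apply: rpred_sum => i _; apply/rpredZ/memv_span.
  by apply/mapP; exists i; rewrite ?mem_enum.
apply/span_subvP => _ /mapP[i _ ->]; rewrite rowE.
by apply/memv_imgP; exists (delta_mx 0 i); rewrite ?memvf // encoderE.
Qed.

(** The image of the encoder is [C], of the same dimension [k] as the source, so rank-nullity leaves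
    a zero kernel. *)
Lemma generator_inj {F : finFieldType} {n k : nat}
    {C : {vspace 'rV[F]_n}} {G : 'M[F]_(k, n)} (b : 'rV[F]_k) :
  is_generator_matrix C G -> (b *m G == 0) = (b == 0).
Proof.
move=> hG; apply/eqP/eqP => [bG0|->]; last exact: mul0mx.
have dimC : \dim C = k.
  by case/andP: hG => /eqP <- /eqP ->; rewrite size_map size_enum_ord.
have := limg_ker_dim (encoder G) fullv.
rewrite (generator_codewords hG) dimC capfv dimvf dim_matrix mul1r.
move/eqP; rewrite -[X in _ == X]add0n eqn_add2r dimv_eq0 => /eqP ker0.
have : b \in lker (encoder G) by rewrite memv_ker encoderE bG0.
by rewrite ker0 memv0 => /eqP.
Qed.

Theorem lemma3p1 (F : finFieldType) (n k : nat) (C : {vspace 'rV[F]_n})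
    (hC : is_linear_code k C)
    (G : 'M[F]_(k, n)) (hG : is_generator_matrix C G)
    (c : 'rV[F]_n) (hc : c \in C) (hc0 : c != 0)
    (a : 'rV[F]_k) (hca : c = a *m G) :
  (minimal_codeword C c <->
     span_points (points_in (point_multiset G) (hyperplane a)) = hyperplane a)
  /\
  (span_points (points_in (point_multiset G) (hyperplane a)) = hyperplane a <->
     \dim (span_points (points_in (point_multiset G) (hyperplane a))) =
       (k - 1)%N).
Proof.
have memC b : b *m G \in C.
  rewrite -(generator_codewords hG).
  by apply/memv_imgP; exists b; rewrite ?memvf // encoderE.
have a0 : a != 0 by rewrite -(generator_inj a hG) -hca.
have sSH := span_points_in_sub G (hyperplane a).
set S := span_points _ in sSH *.
split; last first.
  split=> [->|dimS]; first exact: dim_hyperplane.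
  by apply/eqP; rewrite eqEdim sSH dimS dim_hyperplane /=.
split=> [[_ _ min_c]|eqSH].
  apply/eqP; rewrite eqEsubv sSH; apply/subvP => x xH.
  apply: contraT => /separating_hyperplane[b sSb xb].
  (* The scalar [t] makes coordinate [i] of [(b - t *: a) *m G] vanish, while [i] stays in the
     support of [c]: this makes the inclusion of supports proper. *)
  have /rV0Pn[i ci0] := hc0; pose t := (b *m G) 0 i / c 0 i.
  have b'0 : b - t *: a != 0.
    apply: contraNneq xb => /eqP; rewrite subr_eq0 => /eqP ->.
    move: xH; rewrite !mem_hyperplane -scalemxAl => /eqP ->.
    by rewrite scaler0.
  suff proper_supp : supp ((b - t *: a) *m G) \proper supp c.
    have := min_c _ (memC (b - t *: a)).
    by rewrite (generator_inj _ hG) proper_supp => /(_ b'0).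
  rewrite properE {1}hca supp_sub_span_points; apply/andP; split.
    (* Both [b] and [a] vanish on [S], hence so does their combination. *)
    apply/subvP => y yS; rewrite mem_hyperplane mulmxBl -scalemxAl.
    have /eqP -> : b *m y == 0 by rewrite -mem_hyperplane (subvP sSb).
    have /eqP -> : a *m y == 0 by rewrite -mem_hyperplane (subvP sSH).
    by rewrite scaler0 subrr.
  apply/subsetPn; exists i; rewrite !inE // negbK.
  rewrite mulmxBl -scalemxAl -hca [X in X == _]mxE [X in _ + X]mxE.
  by rewrite [X in _ - X]mxE divfK // subrr.
split=> // c'; rewrite -{1}(generator_codewords hG).
case/memv_imgP => b _ ->; rewrite encoderE (generator_inj _ hG) => b0.
rewrite properE hca !supp_sub_span_points -/S eqSH; apply/negP => /andP[sab].
(* One hyperplane inside another of equal dimension is equal to it, so the supports coincide and the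
   inclusion cannot be proper. *)
have /eqP <- : hyperplane a == hyperplane b.
  by rewrite eqEdim sab !dim_hyperplane ?leqnn.
by rewrite span_points_in_sub.
Qed.
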